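(* Let $k,n$ be positive integers such that $n\ge 4$ and $2\le k\le n$. Then there exists a connected graph $G$ of order $n$ such that $\Delta(G)=n-2$ and $\gamma_{11}(G)=k$ if and only if $(k,n)\notin\{(3,4),(4,4),(4,5),(5,5)\}$.
   Context: All graphs are finite, undirected, simple and connected. The order of $G$ is its number of vertices, and $\Delta(G)$ is its maximum degree. A set $S\subseteq V(G)$ is a perfect dominating set if every vertex not in $S$ is adjacent to exactly one vertex of $S$ (in particular $S=V(G)$ is allowed). The perfect domination number $\gamma_{11}(G)$ is the minimum cardinality of a perfect dominating set of $G$. *)

(* Defs.v *)
From mathcomp Require Import all_boot.

Set Implicit Arguments.
Unset Strict Implicit.
Unset Printing Implicit Defensive.

Record sgraph := SGraph {
  vertex :> finType;
  adj : rel vertex;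
  adj_sym : symmetric adj;
  adj_irrefl : irreflexive adj
}.

Section Invariants.
Variable G : sgraph.
Implicit Types (x v : G) (S : {set G}).

(* Vacuously true of the graph with no vertices. *)
Definition connected : Prop := forall x y : G, connect (@adj G) x y.

Definition neighbours v : {set G} := [set x | adj v x].

Definition max_degree : nat := \max_(v : G) #|neighbours v|.

Definition perfect_dominating S : bool :=
  [forall v, (v \notin S) ==> (#|neighbours v :&: S| == 1)].

Lemma perfect_dominatingT : perfect_dominating [set: G].
Proof. by apply/forallP => v; rewrite inE. Qed.

(* The default [set: G] of the arg min is itself perfect dominating, so this
   is the minimum cardinality of a perfect dominating set: see gamma11P. *)
Definition gamma11 : nat :=
  #|[arg min_(S < [set: G] | perfect_dominating S) #|S| ]|.

Lemma gamma11P :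
  (exists2 S, perfect_dominating S & #|S| = gamma11) /\
  (forall S, perfect_dominating S -> gamma11 <= #|S|).
Proof.
rewrite /gamma11; case: arg_minnP => [|S pS minS].
  exact: perfect_dominatingT.
by split; [exists S | exact: minS].
Qed.

End Invariants.

(* Main.v *)
Require Import Defs.
From mathcomp Require Import all_boot.
From mathcomp Require Import zify.

Set Implicit Arguments.
Unset Strict Implicit.
Unset Printing Implicit Defensive.

(** A graph G of order n has maximum degree n - 2 exactly when no vertex is
    adjacent to all the others and some hub u has a single non-neighbour w
    besides itself ([hub_max_degree], [max_degree_hub]). This constrains a
    perfect dominating set S tightly.

    - If u is outside S, then S contains exactly one neighbour x of u, so S is
      included in {x, w}; it is equal to {x, w} because {x} alone would make x
      universal. Every other vertex is then adjacent to exactly one of x and w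
      ([hub_notin]).
    - If u is in S, then a neighbour y of u that is adjacent to another element
      of S already has two neighbours in S, hence lies in S
      ([hub_in_closed]). So, inside N(u), S is a union of connected components
      of the graph induced on N(u), and S contains all of N(w) if w is in S, but
      exactly one element of N(w) if it is not.

    Two families realise all the values claimed. In both, 0 is the hub u and 1
    is its non-neighbour w.

    - 2 <= k <= n - 2: a k-clique containing u but not w, with w a leaf attached
      to a second vertex of the clique, and the n - k - 1 >= 1 other vertices
      leaves attached to u. The clique is a minimum perfect dominating set.
    - 4 <= k <= n and n >= 6: among the neighbours of u, a double star spanning
      k - 2 vertices; w is adjacent to the two centres of the double star, and
      the n - k other vertices are leaves attached to u. If S contains
      u, then it contains both centres or neither, as they are adjacent; since w
      is adjacent to both, S contains w, and then the whole double star. A set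
      {x, w} is excluded by comparing the neighbours of x and w.

    What these families do not reach is k > 2 with n = 4 and k > 3 with n = 5.
    There, u and w, a neighbour x of w and a non-neighbour z of x exhaust the
    graph up to at most one vertex, and a case analysis produces a perfect
    dominating set of size at most n - 2 ([gamma11_order4],
    [gamma11_order5]). *)

(** * Perfect dominating sets *)

Section PerfectDomination.
Variable G : sgraph.
Implicit Types (s t u v w x z : G) (S : {set G}).

(** The unique neighbour is named by a boolean equation on all of S, so that
    one hypothesis gives both its existence and its uniqueness. *)
Lemma perfect_dominatingP S :
  reflect (forall v, v \notin S ->
             exists2 s, s \in S & forall t, t \in S -> adj v t = (t == s))
          (perfect_dominating S).
Proof.
apply: (iffP forallP) => pdS v; last first.
  apply/implyP => /pdS[s Ss adjv]; apply/cards1P; exists s.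
  apply/setP => t; rewrite !inE.
  have [St|nSt] := boolP (t \in S); first by rewrite andbT adjv.
  by rewrite andbF; apply/esym/eqP => ts; rewrite ts Ss in nSt.
move=> nSv; have /cards1P[s Ns] := implyP (pdS v) nSv.
exists s => [|t St]; first by have := set11 s; rewrite -Ns inE => /andP[].
by move/setP/(_ t): Ns; rewrite !inE St andbT.
Qed.

Lemma perfect_dominating_ex S v :
  perfect_dominating S -> v \notin S -> exists2 s, s \in S & adj v s.
Proof.
move=> /perfect_dominatingP pdS /pdS[s Ss adjv]; exists s => //.
by rewrite adjv.
Qed.

Lemma perfect_dominating_uniq S v s t :
  perfect_dominating S -> v \notin S -> s \in S -> t \in S ->
  adj v s -> adj v t -> s = t.
Proof.
move=> /perfect_dominatingP pdS /pdS[r _ adjv] Ss St.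
by rewrite !adjv // => /eqP-> /eqP->.
Qed.

Lemma perfect_dominating2P x y :
    x != y ->
  perfect_dominating [set x; y] <->
  (forall v, v != x -> v != y -> adj v x (+) adj v y).
Proof.
move=> xy; split=> [pdxy v vx vy|dom].
  have nxy : v \notin [set x; y] by rewrite !inE negb_or vx.
  have [s] := perfect_dominating_ex pdxy nxy.
  case avx: (adj v x); case avy: (adj v y) => //; last first.
    by case/set2P=> ->; rewrite ?avx ?avy.
  move=> _ _; case/eqP: xy.
  exact: perfect_dominating_uniq pdxy nxy (set21 x y) (set22 x y) avx avy.
apply/perfect_dominatingP => v.
rewrite !inE negb_or => /andP[vx vy].
have := dom v vx vy; case avx: (adj v x); case avy: (adj v y) => // _.
- exists x => [|t]; first by rewrite set21.
  by case/set2P=> ->; rewrite ?avx ?avy ?eqxx // eq_sym (negbTE xy).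
- exists y => [|t]; first by rewrite set22.
  by case/set2P=> ->; rewrite ?avx ?avy ?eqxx // (negbTE xy).
Qed.

Lemma gamma11_eq k S :
    perfect_dominating S -> #|S| = k ->
    (forall S', perfect_dominating S' -> k <= #|S'|) ->
  gamma11 G = k.
Proof.
move=> pdS cardS lb; have [[S' pdS' <-] min] := gamma11P G.
by apply/eqP; rewrite eqn_leq lb // andbT -cardS min.
Qed.

(** * Graphs of maximum degree two less than the order *)

(** A vertex of degree [#|G| - 2], together with the vertex that it misses. *)
Definition hub u w := u != w /\ neighbours u = ~: [set u; w].

Definition no_universal := forall x, exists2 z, z != x & ~~ adj x z.

Lemma hub_adj u w v : hub u w -> adj u v = (v != u) && (v != w).
Proof. by case=> _ /setP/(_ v); rewrite !inE negb_or. Qed.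

Lemma no_universal_degree x :
  no_universal -> #|neighbours x| <= #|G| - 2.
Proof.
move=> /(_ x)[z zx nxz].
have -> : #|G| - 2 = #|~: [set x; z]|.
  by rewrite -(cardsC [set x; z]) cards2 eq_sym zx addKn.
apply/subset_leq_card/subsetP => v; rewrite !inE => xv.
by apply/norP; split; apply: contraTneq xv => ->; rewrite ?adj_irrefl.
Qed.

Lemma hub_max_degree u w :
  hub u w -> no_universal -> max_degree G = #|G| - 2.
Proof.
move=> [uw Nu] nuG; apply/eqP; rewrite eqn_leq; apply/andP; split.
  by apply/bigmax_leqP => x _; apply: no_universal_degree.
have -> : #|G| - 2 = #|neighbours u|.
  by rewrite Nu -(cardsC [set u; w]) cards2 uw addKn.
exact: (leq_bigmax u).
Qed.

Lemma degree_nonneighbour u :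
  1 < #|G| -> #|neighbours u| <= #|G| - 2 -> exists2 w, w != u & ~~ adj u w.
Proof.
move=> G1 degu; have : 0 < #|~: (u |: neighbours u)|.
  move: G1 degu; rewrite -(cardsC (u |: neighbours u)) cardsU1 !inE adj_irrefl.
  by lia.
case/card_gt0P => w; rewrite !inE => /norP[wu nuw]; by exists w.
Qed.

Lemma max_degree_hub :
  1 < #|G| -> max_degree G = #|G| - 2 ->
  (exists u w, hub u w) /\ no_universal.
Proof.
move=> G1 Dn; split; last first.
  move=> x; apply: degree_nonneighbour => //.
  by rewrite -Dn; apply: (leq_bigmax x).
have [|u degu] := @eq_bigmax G (fun v => #|neighbours v|); first by lia.
have {degu}degu : #|neighbours u| = #|G| - 2 by rewrite -Dn /max_degree degu.
have [w wu nuw] : exists2 w, w != u & ~~ adj u w.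
  by apply: degree_nonneighbour; rewrite ?degu.
exists u, w; split; first by rewrite eq_sym.
apply/eqP; rewrite eqEcard; apply/andP; split.
  apply/subsetP => v; rewrite !inE => uv.
  by apply/norP; split; apply: contraTneq uv => ->; rewrite ?adj_irrefl.
by rewrite degu -(cardsC [set u; w]) cards2 eq_sym wu addKn.
Qed.

Lemma connected_neighbour w u : connected G -> w != u -> exists x, adj w x.
Proof.
move=> /(_ w u)/connectP[[|x p] /= pth ->]; first by rewrite eqxx.
by case/andP: pth => wx _ _; exists x.
Qed.

Section HubSets.
Variables (u w : G) (S : {set G}).
Hypotheses (Guw : hub u w) (pdS : perfect_dominating S).

(** The unique neighbour x of u in S is the only element of S outside {u, w},
    since u is adjacent to everything else. Were w not in S, S would be {x},
    and perfect domination by a single vertex makes that vertex universal. *)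
Lemma hub_notin :
    no_universal -> u \notin S ->
  exists x, [/\ adj u x, S = [set x; w] &
                forall v, v != x -> v != w -> adj v x (+) adj v w].
Proof.
move=> nuG Su; have [x Sx ux] := perfect_dominating_ex pdS Su.
have eqx t : t \in S -> t != w -> t = x.
  move=> St tw; apply: (perfect_dominating_uniq pdS Su) => //.
  by rewrite (hub_adj _ Guw) tw andbT; apply: contraTneq St => ->.
have Sw : w \in S.
  apply/negPn/negP => Sw; have notw t : t \in S -> t = x.
    by move=> St; apply: eqx => //; apply: contraTneq St => ->.
  have [z zx /negP[]] := nuG x.
  have Sz : z \notin S by apply: contraNN zx => /notw->.
  by have [s /notw-> zs] := perfect_dominating_ex pdS Sz; rewrite adj_sym.
have defS : S = [set x; w].
  apply/setP => t; rewrite !inE; apply/idP/orP => [St|[]/eqP->//].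
  by have [->|/(eqx t St)->] := eqVneq t w; [right | left].
exists x; split=> //; apply/perfect_dominating2P; last by rewrite -defS.
by move: ux; rewrite (hub_adj _ Guw) => /andP[].
Qed.

(** Otherwise y would have the two distinct neighbours u and x in S. *)
Lemma hub_in_closed x y :
  u \in S -> x \in S -> adj u y -> adj x y -> x != u -> y \in S.
Proof.
move=> Su Sx uy xy xu; apply/negPn/negP => Sy; case/eqP: xu.
by apply: (perfect_dominating_uniq pdS Sy) => //; rewrite adj_sym.
Qed.

End HubSets.

Lemma gamma11_leq S m : perfect_dominating S -> #|S| <= m -> gamma11 G <= m.
Proof. by move=> /(gamma11P G).2; apply: leq_trans. Qed.

Lemma uniq_spanning (s : seq G) v : uniq s -> size s = #|G| -> v \in s.
Proof.
move=> /card_uniqP cards; rewrite -cards => cardsG.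
by rewrite (subset_cardP cardsG (subset_predT _)).
Qed.

(** Connectedness gives w a neighbour x, which is not u; x is not universal, and
    it is adjacent to both u and w, so any z that it misses is a fourth
    vertex. *)
Lemma hub_frame :
    connected G -> 1 < #|G| -> max_degree G = #|G| - 2 ->
  no_universal /\
  exists u w x z,
    [/\ hub u w, uniq [:: u; w; x; z], adj w x & ~~ adj x z].
Proof.
move=> conG G1 /(max_degree_hub G1)[[u [w Guw]] nuG]; split=> //.
have uw : u != w by case: Guw.
have [x wx] : exists x, adj w x.
  by apply: (connected_neighbour (u := u)) => //; rewrite eq_sym.
have [z zx nxz] := nuG x; exists u, w, x, z; split=> //.
have xw : x != w by apply: contraTneq wx => ->; rewrite adj_irrefl.
have xu : x != u.
  by apply: contraTneq wx => ->; rewrite adj_sym (hub_adj _ Guw) eqxx andbF.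
have zu : z != u.
  by apply: contraNneq nxz => ->; rewrite adj_sym (hub_adj _ Guw) xu.
have zw : z != w by apply: contraNneq nxz => ->; rewrite adj_sym.
by rewrite /= !inE !negb_or uw !(eq_sym u) !(eq_sym w) xu zu xw zw eq_sym zx.
Qed.

End PerfectDomination.

(** * Orders four and five *)

(** The set {u, x} works: w is adjacent only to x in it, and z only to u. *)
Lemma gamma11_order4 (G : sgraph) :
  connected G -> #|G| = 4 -> max_degree G = #|G| - 2 -> gamma11 G <= 2.
Proof.
move=> conG G4 Dn.
have [|_ [u [w [x [z [Guw Uuwxz wx nxz]]]]]] := hub_frame conG _ Dn.
  by rewrite G4.
have mem4 v : v \in [:: u; w; x; z] by apply: uniq_spanning; rewrite ?G4.
have adju v := hub_adj v Guw.
move: Uuwxz; rewrite /= !inE !negb_or -!andbA.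
case/and5P=> uw ux uz wx' /and3P[wz xz _].
apply: (@gamma11_leq _ [set u; x]); last by rewrite cards2 ux.
apply/perfect_dominating2P => // v vu vx.
have := mem4 v; rewrite !inE (negbTE vu) (negbTE vx) /= => /orP[]/eqP->.
  by rewrite adj_sym adju eqxx andbF wx.
by rewrite adj_sym adju !(eq_sym z) uz wz adj_sym (negbTE nxz).
Qed.

(** With y the fifth vertex, the edges left to decide are xy, wy, wz and yz. One
    of the pairs {u, x}, {u, z}, {w, z} and {x, w} is perfect dominating, unless
    xy is the only edge among these four; then {x, y} is a component of the
    graph induced on x, y, z, and {u, x, y} works. *)
Lemma gamma11_order5 (G : sgraph) :
  connected G -> #|G| = 5 -> max_degree G = #|G| - 2 -> gamma11 G <= 3.
Proof.
move=> conG G5 Dn.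
have [|nuG [u [w [x [z [Guw Uuwxz wx /negbTE xz]]]]]] := hub_frame conG _ Dn.
  by rewrite G5.
have [y Ny] : exists y, y \notin [:: u; w; x; z].
  apply/existsP; apply: contraT; rewrite negb_exists => /forallP mem4.
  have /subset_leq_card : [set: G] \subset [:: u; w; x; z].
    by apply/subsetP => v _; have := mem4 v; rewrite negbK.
  by rewrite cardsT G5 => /leq_trans/(_ (card_size _)).
have Uy : uniq [:: y; u; w; x; z] by rewrite cons_uniq Ny.
have mem5 v : v \in [:: y; u; w; x; z] by apply: uniq_spanning; rewrite ?G5.
have adju v := hub_adj v Guw.
have adjC a b : @adj G a b = adj b a by rewrite adj_sym.
move: Uy; rewrite /= !inE !negb_or -!andbA.
case/and5P=> yu yw yx yz /and5P[uw ux uz wx' /and3P[wz xz' _]].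
have E (a b : G) : a != b -> ((a == b) = false) * ((b == a) = false).
  by rewrite eq_sym => /negbTE->.
have neqE := (E _ _ yu, E _ _ yw, E _ _ yx, E _ _ yz, E _ _ uw, E _ _ ux,
  E _ _ uz, E _ _ wx', E _ _ wz, E _ _ xz').
have adjCu v : adj v u = (v != u) && (v != w) by rewrite adjC.
have adjE := (adju, adjCu, adjC x w, wx, xz, adjC z x).
have pair p q : p != q ->
    all (fun v => [|| v == p, v == q | adj v p (+) adj v q])
      [:: y; u; w; x; z] ->
  gamma11 G <= 3.
  move=> pq /allP dom; apply: (@gamma11_leq _ [set p; q]).
    apply/perfect_dominating2P => // v vp vq.
    by have := dom v (mem5 v); rewrite (negbTE vp) (negbTE vq).
  by rewrite cards2 pq.
(* If y were adjacent to w, x and z, it would be universal, as u is adjacent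
   to it. *)
have noty : ~~ [&& adj y w, adj y x & adj y z].
  have [t ty] := nuG y; apply: contra => /and3P[yw' yx' yz'].
  have := mem5 t; rewrite !inE (negbTE ty) /=.
  by case/or4P=> /eqP->; rewrite // adjC adju neqE.
have [yx'|/negbTE yx'] := boolP (adj y x); last first.
  by apply: (pair u x); rewrite ?neqE //= !(adjE, neqE, eqxx) yx' !orbT.
have [yw'|/negbTE yw'] := boolP (adj y w).
  have {noty}yz' : adj y z = false
    by apply: negbTE; move: noty; rewrite yw' yx'.
  have [wz'|/negbTE wz'] := boolP (adj w z).
    by apply: (pair u z); rewrite ?neqE //= !(adjE, neqE, eqxx) yz' wz' !orbT.
  by apply: (pair w z); rewrite ?neqE //= !(adjE, neqE, eqxx) yw' yz' !orbT.
have [wz'|/negbTE wz'] := boolP (adj w z).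
  apply: (pair x w); rewrite ?neqE //= !(adjE, neqE, eqxx) yw' yx'.
  by rewrite (adjC z w) wz' !orbT.
have [yz'|/negbTE yz'] := boolP (adj y z).
  by apply: (pair w z); rewrite ?neqE //= !(adjE, neqE, eqxx) yw' yz' !orbT.
apply: (@gamma11_leq _ [set u; x; y]); last first.
  by rewrite setUC cardsU1 cards2; case: (_ \notin _) (_ != _) => [] [].
apply/perfect_dominatingP => v; rewrite !inE => nv.
have := mem5 v; rewrite !inE; move: nv; rewrite !negb_or => /andP[/andP[]].
move=> /negbTE-> /negbTE-> /negbTE-> /= /orP[]/eqP->.
- exists x => [|t]; rewrite !inE ?eqxx ?orbT // -orbA.
  by case/or3P=> /eqP->; rewrite ?(adjC w y) ?adjE ?yw' ?neqE ?eqxx ?andbF.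
- exists u => [|t]; rewrite !inE ?eqxx ?orbT // -orbA.
  by case/or3P=> /eqP->; rewrite ?(adjC z y) ?adjE ?yz' ?neqE ?eqxx.
Qed.

(** * Graphs given by arcs between numbers *)

Section ArcGraph.
Variables (n : nat) (d : rel nat).

(** Only arcs from a smaller to a larger number are read, and they are then
    symmetrised, so that any [d] yields a simple graph. *)
Definition arc_adj : rel 'I_n :=
  fun i j => (i < j) && d i j || (j < i) && d j i.

Lemma arc_adj_sym : symmetric arc_adj.
Proof. by move=> i j; rewrite /arc_adj orbC. Qed.

Lemma arc_adj_irrefl : irreflexive arc_adj.
Proof. by move=> i; rewrite /arc_adj ltnn. Qed.

Definition arc_graph := SGraph arc_adj_sym arc_adj_irrefl.

Lemma arc_adjE (i j : arc_graph) :
  adj i j = (i < j) && d i j || (j < i) && d j i.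
Proof. by []. Qed.

Hypothesis d0 : forall j, d 0 j = (1 < j).

Lemma arc_graph_hub (lt_0n : 0 < n) (lt_1n : 1 < n) :
  hub (Ordinal lt_0n : arc_graph) (Ordinal lt_1n).
Proof.
split=> //; apply/setP => i.
by rewrite !inE arc_adjE d0 -!val_eqE /=; lia.
Qed.

Hypotheses (n3 : 2 < n) (d12 : d 1 2).

Lemma arc_graph_connected : connected arc_graph.
Proof.
have [lt_0n lt_1n lt_2n] : [/\ 0 < n, 1 < n & 2 < n] by split; lia.
pose v0 : arc_graph := Ordinal lt_0n; pose v1 : arc_graph := Ordinal lt_1n.
pose v2 : arc_graph := Ordinal lt_2n.
have con2 : connect (@adj arc_graph) v0 v2.
  by apply: connect1; rewrite arc_adjE d0.
have con0 i : connect (@adj arc_graph) v0 i.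
  have [->|i0] := eqVneq i v0; first exact: connect0.
  have [->|i1] := eqVneq i v1.
    by apply: connect_trans con2 (connect1 _); rewrite arc_adjE /= d12.
  by apply: connect1; rewrite (hub_adj _ (arc_graph_hub lt_0n lt_1n)) i0.
move=> i j; apply: connect_trans (con0 j).
by rewrite (sym_connect_sym arc_adj_sym).
Qed.

Lemma arc_graph_realizes k (S : {set arc_graph}) :
    no_universal arc_graph -> perfect_dominating S -> #|S| = k ->
    (forall S', @perfect_dominating arc_graph S' -> k <= #|S'|) ->
  exists G : sgraph,
     [/\ connected G, #|G| = n, max_degree G = n - 2 & gamma11 G = k].
Proof.
have [lt_0n lt_1n] : 0 < n /\ 1 < n by split; lia.
move=> nuG pdS Sk lb; exists arc_graph; split.
- exact: arc_graph_connected.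
- exact: card_ord.
- by rewrite (hub_max_degree (arc_graph_hub lt_0n lt_1n) nuG) card_ord.
- exact: (gamma11_eq pdS Sk lb).
Qed.

End ArcGraph.

Lemma card_initial_segment n k : k <= n -> #|[set i : 'I_n | i < k]| = k.
Proof.
move=> kn; rewrite -sum1dep_card -(big_ord_widen n (fun=> 1)) //.
by rewrite sum1_card card_ord.
Qed.

(** * A clique with leaves: the values up to n - 2 *)

Section Clique.
Variables (n k : nat).
Hypotheses (k2 : 1 < k) (kn : k.+1 < n).

(** The clique is {0, 2, ..., k}; the vertex 1 is a leaf at 2, and the vertices
    after k are leaves at 0. *)
Definition clique_arc : rel nat := fun i j =>
  match i with
  | 0 => 1 < j
  | 1 => j == 2
  | _ => j <= k
  end.

Local Notation G := (arc_graph n clique_arc).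

Let n4 : 3 < n.
Proof. by lia. Qed.

Let vtx i (i4 : i < 4) : G := Ordinal (leq_trans i4 n4).
Local Notation v0 := (@vtx 0 isT).
Local Notation v1 := (@vtx 1 isT).
Local Notation v2 := (@vtx 2 isT).
Local Notation v3 := (@vtx 3 isT).
Let vlast : G := Ordinal kn.

Let hubG : hub v0 v1.
Proof. exact: arc_graph_hub. Qed.

Lemma clique_no_universal : no_universal G.
Proof.
case=> [[|[|[|i]]] lt_in].
- by exists v1.
- by exists v0.
- by exists vlast; rewrite -?val_eqE ?arc_adjE /=; lia.
- by exists v1.
Qed.

Let core : {set G} := [set i : G | i < k.+1] :\ v1.

Let card_core : #|core| = k.
Proof.
have v1_in : v1 \in [set i : G | i < k.+1] by rewrite inE /=; lia.
have := cardsD1 v1 [set i : G | i < k.+1].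
by rewrite card_initial_segment ?v1_in ?(ltnW kn) // => -[].
Qed.

Lemma clique_core_dominating : perfect_dominating core.
Proof.
apply/perfect_dominatingP => v; rewrite !inE -val_eqE /= => nv.
have [v1E|v1N] := eqVneq (v : nat) 1.
  exists v2 => [|t]; rewrite !inE -!val_eqE /=; first by lia.
  by rewrite /arc_adj v1E; case: (t : nat) => [|[|[|m]]] /=; lia.
exists v0 => [|t]; rewrite !inE -!val_eqE /=; first by lia.
have {v1N nv}kv : k < v by lia.
by rewrite /arc_adj => tk; case: (t : nat) tk => [|[|m]] /=;
  case: (v : nat) kv => [|[|w]] /=; lia.
Qed.

(** If S contains 0, it contains 2, either as the only neighbour of 1 or
    because 2 is adjacent to both 0 and 1; the rest of the clique follows by
    [hub_in_closed]. Otherwise S = {x, 1}, which has too few elements only when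
    k > 2; some vertex then violates perfect domination, namely a leaf at 0 if
    x = 2, the vertex 2 if x is another vertex of the clique, and 3 if x is a
    leaf. *)
Lemma clique_core_min S : @perfect_dominating G S -> k <= #|S|.
Proof.
move=> pdS; have [S0|nS0] := boolP (v0 \in S).
  have S2 : v2 \in S.
    have [S1|nS1] := boolP (v1 \in S); first exact: (hub_in_closed pdS S0 S1).
    have [s Ss] := perfect_dominating_ex pdS nS1; rewrite arc_adjE /= => a1s.
    suff s2 : s = 2 :> nat by rewrite -(_ : s = v2) //; apply: val_inj.
    by move: a1s; case: (s : nat) => [|[|m]] //=; lia.
  rewrite -[leqLHS]card_core; apply/subset_leq_card/subsetP => i.
  rewrite !inE -val_eqE /= => ik.
  have [i0|i0] := eqVneq (i : nat) 0.
    by rewrite (_ : i = v0) //; apply: val_inj.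
  have [i2|i2] := eqVneq (i : nat) 2.
    by rewrite (_ : i = v2) //; apply: val_inj.
  by apply: (hub_in_closed pdS S0 S2) => //; rewrite arc_adjE /=; lia.
have [x [a0x defS dom]] := hub_notin hubG pdS clique_no_universal nS0.
move: a0x; rewrite arc_adjE /= => a0x.
have [k_2|k3] := leqP k 2.
  by rewrite defS cards2 -val_eqE /=; lia.
exfalso; have [x2|x2] := eqVneq (x : nat) 2.
  by have := dom vlast; rewrite -!val_eqE !arc_adjE /= x2 /=; lia.
have [xk|kx] := leqP x k.
  by have := dom v2; rewrite -!val_eqE !arc_adjE /=; lia.
have := dom v3; rewrite -!val_eqE !arc_adjE /=.
by case: (x : nat) kx k3 => [|[|m]] /=; lia.
Qed.

Lemma clique_realizes :
  exists G : sgraph,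
     [/\ connected G, #|G| = n, max_degree G = n - 2 & gamma11 G = k].
Proof.
apply: (arc_graph_realizes (d := clique_arc) _ _ _
  clique_no_universal clique_core_dominating card_core clique_core_min) => //.
exact: ltnW.
Qed.

End Clique.

(** * A double star with leaves: the values close to n *)

Section DoubleStar.
Variables (n k : nat).
Hypotheses (n6 : 5 < n) (k4 : 3 < k) (kn : k <= n).

(** The centres of the double star are 2 and 3, and 1 is adjacent to both. The
    centre 2 gets the single leaf 4 (when k > 4) and 3 gets the leaves 5, ...,
    k - 1; the vertices from k on are leaves at 0. Splitting the leaves of the
    double star between both centres keeps either centre from being universal
    when k = n: as n >= 6, the vertex 2 misses 5 and the vertex 3 misses 4. *)
Definition double_star_arc : rel nat := fun i j =>
  match i with
  | 0 => 1 < j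
  | 1 => (j == 2) || (j == 3)
  | 2 => (j == 3) || (j == 4) && (4 < k)
  | 3 => (4 < j) && (j < k)
  | _ => false
  end.

Local Notation G := (arc_graph n double_star_arc).

Let vtx i (i6 : i < 6) : G := Ordinal (leq_trans i6 n6).
Local Notation v0 := (@vtx 0 isT).
Local Notation v1 := (@vtx 1 isT).
Local Notation v2 := (@vtx 2 isT).
Local Notation v3 := (@vtx 3 isT).
Local Notation v4 := (@vtx 4 isT).
Local Notation v5 := (@vtx 5 isT).

Let hubG : hub v0 v1.
Proof. exact: arc_graph_hub. Qed.

Lemma double_star_no_universal : no_universal G.
Proof.
case=> [[|[|[|[|i]]]] lt_in].
- by exists v1.
- by exists v0.
- by exists v5.
- by exists v4.
- by exists v1.
Qed.

Lemma double_star_core_dominating : @perfect_dominating G [set i : G | i < k].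
Proof.
apply/perfect_dominatingP => -[v lt_vn]; rewrite inE => /= kv.
exists v0 => [|[t lt_tn]]; first by rewrite inE /=; lia.
rewrite inE /arc_adj -val_eqE /= => tk.
by case: t tk {lt_tn} => [|[|[|[|t]]]] /= tk;
  case: v kv {lt_vn} => [|[|[|[|v]]]] /=; lia.
Qed.

(** If S contains 0, then 2 and 3 are in S together or not at all, so that 1,
    which is adjacent to exactly these two, cannot be outside S; the double star
    follows by [hub_in_closed]. Otherwise S = {x, 1}, and a violation occurs at
    the centre 2 if x is 3 or a leaf of 2, at the centre 3 if x is 2 or a leaf
    of 3, and at 4 or 5, whichever is not x, if x is a leaf at 0. *)
Lemma double_star_core_sub (S : {set G}) :
  perfect_dominating S -> [set i : G | i < k] \subset S.
Proof.
move=> pdS; have [S0|nS0] := boolP (v0 \in S).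
  have S23 : (v2 \in S) = (v3 \in S).
    by apply/idP/idP => [S2|S3]; [apply: (hub_in_closed pdS S0 S2)
                                 |apply: (hub_in_closed pdS S0 S3)].
  have S1 : v1 \in S.
    apply/negPn/negP => nS1; have [s Ss] := perfect_dominating_ex pdS nS1.
    rewrite arc_adjE => a1s; have S2 : v2 \in S.
      case: s Ss a1s => -[|[|[|[|s]]]] lt_sn //= Ss _.
        by rewrite -(_ : Ordinal lt_sn = v2) //; apply: val_inj.
      by rewrite S23 -(_ : Ordinal lt_sn = v3) //; apply: val_inj.
    have S3 := S2; rewrite S23 in S3.
    by have := perfect_dominating_uniq pdS nS1 S2 S3 isT isT.
  have S2 : v2 \in S by apply: (hub_in_closed pdS S0 S1).
  have S3 : v3 \in S by apply: (hub_in_closed pdS S0 S1).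
  apply/subsetP => i; rewrite inE => ik.
  have eqv j (j6 : j < 6) : i = j :> nat -> i = vtx j6.
    by move=> ij; apply: val_inj.
  have [/eqv->//|i0] := eqVneq (i : nat) 0.
  have [/eqv->//|i1] := eqVneq (i : nat) 1.
  have [/eqv->//|i2] := eqVneq (i : nat) 2.
  have [/eqv->//|i3] := eqVneq (i : nat) 3.
  have [i4|i4] := eqVneq (i : nat) 4.
    by apply: (hub_in_closed pdS S0 S2) => //; rewrite arc_adjE /=; lia.
  by apply: (hub_in_closed pdS S0 S3) => //; rewrite arc_adjE /=; lia.
have [x [a0x _ dom]] := hub_notin hubG pdS double_star_no_universal nS0.
exfalso; move: a0x; rewrite arc_adjE /= => a0x.
have [xk|kx] := ltnP x k.
  have [x34|x34] := boolP ((x == 3 :> nat) || (x == 4 :> nat)).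
    by have := dom v2; rewrite -!val_eqE !arc_adjE /=; lia.
  have x25 : (x == 2 :> nat) || (4 < x) by lia.
  have := dom v3; rewrite -!val_eqE !arc_adjE /=.
  by case/orP: x25 => [/eqP->/(_ isT isT)|] //; lia.
have [x4|x4] := eqVneq (x : nat) 4.
  by have := dom v5; rewrite -!val_eqE !arc_adjE /= x4 /=; lia.
have := dom v4; rewrite -!val_eqE !arc_adjE /=.
by case: (x : nat) kx x4 => [|[|[|[|m]]]] /=; lia.
Qed.

Lemma double_star_realizes :
  exists G : sgraph,
     [/\ connected G, #|G| = n, max_degree G = n - 2 & gamma11 G = k].
Proof.
apply: (arc_graph_realizes (d := double_star_arc) _ _ _
  double_star_no_universal double_star_core_dominating) => //; first by lia.
  exact: card_initial_segment.
move=> S /double_star_core_sub/subset_leq_card; apply: leq_trans.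
by rewrite card_initial_segment.
Qed.

End DoubleStar.

(** * The realisable values *)

Theorem theorem2 (k n : nat) (hn : 4 <= n) (hk2 : 2 <= k) (hkn : k <= n) :
  (exists G : sgraph,
     [/\ connected G, #|G| = n, max_degree G = n - 2 & gamma11 G = k])
  <-> (k, n) \notin [:: (3, 4); (4, 4); (4, 5); (5, 5)].
Proof.
have excE : ((k, n) \notin [:: (3, 4); (4, 4); (4, 5); (5, 5)])
    = ~~ ((n == 4) && (2 < k)) && ~~ ((n == 5) && (3 < k)).
  by rewrite !inE !xpair_eqE; lia.
rewrite excE; split=> [[G [conG Gn Dn gk]]|exc].
  rewrite -Gn in Dn.
  apply/andP; split; apply/negP => /andP[/eqP n_small]; rewrite -gk ltnNge.
    by rewrite gamma11_order4 // Gn.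
  by rewrite gamma11_order5 // Gn.
have [kn|kn] := ltnP k.+1 n; first exact: clique_realizes.
by apply: double_star_realizes => //; lia.
Qed.
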